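(* Let $|G|\subset\mathbb{R}^n$ be a linearly embedded graph with $N_0$ vertices $v_1,\dots,v_{N_0}$ and $N_1$ edges, let $N=N_0+N_1$, and for $i\in\{N_0+1,\dots,N\}$ let $v_{i_1},v_{i_2}$ be the two vertices forming the boundary of the $i$-th stratum (an edge). Let $(X_j,Z_j)$ be random elements on a probability space $(\Omega,\mathcal{F},\mu)$ following the graph mixture model described in the context, with category probabilities $\Pi=(\pi_1,\dots,\pi_N)$ and noise parameters $\sigma_1,\dots,\sigma_N$. Define $\sigma:=\max_i\sigma_i$ and let $\nu_\sigma:=\mu(X_j^{-1})$ be the push-forward measure of $\mu$ through $X_j$. Then 1. $\nu_\sigma\sim dx$, i.e. $\nu_\sigma$ is equivalent to Lebesgue measure on $\mathbb{R}^n$; 2. $\operatorname{supp}\left(\lim_{\sigma\to0}\nu_\sigma\right)=|G|$, where the limit of measures is meant in the weak sense; 3. $\lim_{\sigma\to0}\nu_\sigma(|G|)=1$.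
   Context: A linearly embedded graph $|G|\subset\mathbb{R}^n$ is the image of a finite graph under a map that is injective on vertices, sends each edge $(u,v)$ to the line segment $\overline{uv}$ joining the images of its endpoints, and is such that two distinct embedded edges intersect only if they share a boundary vertex, in which case they meet exactly at that vertex; moreover, at a vertex of degree two the angle between the two embedded edges is not $\pi$. The strata of $|G|$ are its vertices (dimension 0, indexed by $1,\dots,N_0$) and its edges (dimension 1, indexed by $N_0+1,\dots,N$). Graph mixture model: for $j$ ranging over the data points, $X_j$ is an $\mathbb{R}^n$-valued random element and $Z_j$ is a random variable with values in $\{1,\dots,N\}$. The $Z_j$ are independent and identically distributed, and each $X_j$ is independent of $X_i$ and $Z_i$ for $i\neq j$. $Z_j$ has the categorical distribution with parameters $\Pi=(\pi_1,\dots,\pi_N)$, i.e. category $i$ has probability $\pi_i$. Conditionally on $Z_j=i$ with $i\in\{1,\dots,N_0\}$, $X_j$ is normally distributed in $\mathbb{R}^n$ with mean $v_i$ and variance $\sigma_i^2$ (density $(2\pi\sigma_i^2)^{-n/2}e^{-\|x-v_i\|^2/2\sigma_i^2}$). Conditionally on $Z_j=i$ with $i\in\{N_0+1,\dots,N\}$, $X_j$ is distributed as $t\,v_{i_1}+(1-t)\,v_{i_2}+\eta$, where $t$ is uniform on $[0,1]$ and $\eta$ is normal with mean $0$ and variance $\sigma_i^2$, so that its density is $(2\pi\sigma_i^2)^{-n/2}\int_0^1 e^{-\|x-(t v_{i_1}+(1-t)v_{i_2})\|^2/2\sigma_i^2}\,dt$, the convolution of the uniform measure on the segment with the normal density.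
   Formalization: Claim 2 is proved assuming π_i > 0 for every edge and every vertex without incident edge (otherwise the support misses that stratum); claim 3 is proved for the weak limit measure evaluated at |G|, since for n ≥ 2 ν_σ(|G|) = 0 for all σ > 0 by claim 1. *)

(* Defs.v *)
From HB Require Import structures.
From mathcomp Require Import all_boot all_order all_algebra.
From mathcomp Require Import all_classical all_reals all_analysis.
From mathcomp Require Import measurable_realfun lra.

Set Implicit Arguments.
Unset Strict Implicit.
Unset Printing Implicit Defensive.

Import Order.TTheory GRing.Theory Num.Theory.
Import numFieldNormedType.Exports.

Local Open Scope classical_set_scope.
Local Open Scope ring_scope.

(* The Borel sigma-algebra of R^n. *)
HB.instance Definition _ (R : realType) (n : nat) :=
  @isMeasurable.Build (sigma_display (@open 'rV[R]_n)) 'rV[R]_n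
    <<s @open 'rV[R]_n >> (@sigma_algebra0 _ setT (@open 'rV[R]_n))
    (@sigma_algebraC _ (@open 'rV[R]_n))
    (@sigma_algebra_bigcup _ setT (@open 'rV[R]_n)).

Section borel_rV.
Context (R : realType) (n : nat).

Lemma open_measurable_rV (U : set 'rV[R]_n) : open U -> measurable U.
Proof. by move=> oU; exact: sub_sigma_algebra. Qed.

Lemma continuous_measurable_rV_fun (f : 'rV[R]_n -> R) :
  continuous f -> measurable_fun [set: 'rV[R]_n] f.
Proof.
move=> cf; apply: (measurability (@RGenOInfty.G R)).
  exact: RGenOInfty.measurableE.
move=> _ [_ [a ->] <-]; rewrite setTI.
apply: open_measurable_rV; apply: (open_comp (fun x _ => cf x)).
exact: interval_open.
Qed.

Lemma measurable_coord (i : 'I_n) :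
  measurable_fun [set: 'rV[R]_n]
    ((fun v => v ord0 i) : 'rV[R]_n -> measurableTypeR R).
Proof. by apply: continuous_measurable_rV_fun; exact: coord_continuous. Qed.

Let qball (cr : 'rV[rat]_n * rat) : set 'rV[R]_n :=
  ball (map_mx (@ratr R) cr.1) (ratr cr.2 : R).

Let open_qball (U : set 'rV[R]_n) : open U ->
  U = \bigcup_(cr in [set cr | qball cr `<=` U]) qball cr.
Proof.
move=> oU; apply/seteqP; split => [x Ux|x [cr /= + ?]]; last exact.
have /nbhs_ballP[e /= e0 xeU] := open_nbhs_nbhs (conj oU Ux).
have [r] : exists r : rat, (0 : R) < ratr r < e / 2.
  have : (`]0, e / 2[%classic : set R) !=set0.
    by exists (e / 4); rewrite /= in_itv /=; apply/andP; split; lra.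
  move=> /dense_rat /(_ (interval_open _ _)) => /(_ isT isT)[q /= []].
  by rewrite in_itv /= => qe [r _ rq]; exists r; rewrite rq.
move=> /andP[r0 re].
have xc i : exists q : rat, ball (x ord0 i) (ratr r) (ratr q : R).
  have : ball (x ord0 i) (ratr r : R) !=set0.
    by exists (x ord0 i); exact: ballxx.
  by move=> /dense_rat /(_ (ball_open (x ord0 i) (ratr r)))[y [xy [q _ qy]]]; exists q; rewrite qy.
have [c cP] := choice xc.
exists ((\row_i c i), r) => /=; last first.
  by split => // i j; rewrite !mxE ord1; apply: ball_sym.
move=> y [_ yc]; apply: xeU; split => // i j.
have := yc i j; rewrite !mxE !ord1 => /(ball_triangle (cP j)).
by apply: le_ball; lra.
Qed.

Lemma measurable_fun_rV d (T : measurableType d) (f : T -> 'rV[R]_n) :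
  (forall i, measurable_fun [set: T]
     ((fun x => f x ord0 i) : T -> measurableTypeR R)) ->
  measurable_fun [set: T] f.
Proof.
move=> mf; apply: (measurability (@open 'rV[R]_n)) => //.
move=> _ [U oU <-]; rewrite setTI (open_qball oU) preimage_bigcup.
rewrite bigcup_mkcond; apply: countable_bigcupT_measurable => // -[c r].
case: ifPn => // _.
have [r0|r0] := ltP 0 (ratr r : R); last first.
  rewrite (_ : _ @^-1` _ = set0)//; apply/seteqP; split => // x [].
  by rewrite ltNge r0.
rewrite (_ : _ @^-1` _ = \bigcap_(i in [set: 'I_n])
    ((fun x => f x ord0 i) @^-1` ball (ratr (c ord0 i) : R) (ratr r))).
  apply: fin_bigcap_measurable => // i _.
  by rewrite -[X in measurable X]setTI; apply: mf => //; exact: measurable_ball.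
apply/seteqP; split => [x [_ xc] i _ /=|x xc].
  by have := xc ord0 i; rewrite mxE.
rewrite /preimage /qball /=; split => // i j.
by rewrite mxE ord1; exact: (xc j Logic.I).
Qed.

End borel_rV.

Section lebesgue_rV_step.
Context (R : realType) (n : nat).
Variable m : {sigma_finite_measure set 'rV[R]_n -> \bar R}.

Definition cons_rV (p : R * 'rV[R]_n) : 'rV[R]_n.+1 :=
  row_mx (const_mx p.1 : 'rV[R]_1) p.2.

Let uncons_rV (v : 'rV[R]_n.+1) : R * 'rV[R]_n :=
  (v ord0 ord0, rsubmx (v : 'rV[R]_(1 + n))).

Let cons_rVK : cancel cons_rV uncons_rV.
Proof.
move=> [x v]; rewrite /uncons_rV /cons_rV /= row_mxKr; congr pair.
transitivity (row_mx (const_mx x : 'rV[R]_1) v ord0 (lshift n ord0)).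
  by congr (row_mx _ _ _ _); exact/val_inj.
by rewrite row_mxEl mxE.
Qed.

Lemma measurable_cons_rV : measurable_fun [set: R * 'rV[R]_n] cons_rV.
Proof.
apply: measurable_fun_rV => i; rewrite -[i](@splitK 1 n).
case: (fintype.split _) => j.
  rewrite (_ : (fun _ => _) = fst); first exact: measurable_fst.
  by apply/funext => p; apply: etrans (row_mxEl _ _ _ _) _; rewrite mxE.
rewrite (_ : (fun _ => _) = (fun v : 'rV[R]_n => v ord0 j) \o snd).
  by apply: measurableT_comp; [exact: measurable_coord|exact: measurable_snd].
by apply/funext => p; exact: row_mxEr.
Qed.

Let measurable_uncons_rV : measurable_fun [set: 'rV[R]_n.+1] uncons_rV.
Proof.
apply: measurable_fun_pair; first exact: measurable_coord.
apply: measurable_fun_rV => i; under eq_fun do rewrite mxE.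
exact: measurable_coord.
Qed.

Definition lebesgue_cons : set 'rV[R]_n.+1 -> \bar R :=
  pushforward (@lebesgue_measure R \x m)%E cons_rV.

Let lebesgue_cons0 : lebesgue_cons set0 = 0%E.
Proof. by rewrite /lebesgue_cons /pushforward preimage_set0 measure0. Qed.

Let lebesgue_cons_ge0 A : (0 <= lebesgue_cons A)%E.
Proof. by rewrite /lebesgue_cons /pushforward; exact: measure_ge0. Qed.

Let lebesgue_cons_sigma_additive : semi_sigma_additive lebesgue_cons.
Proof.
move=> F mF tF mUF; rewrite /lebesgue_cons /pushforward preimage_bigcup.
have mcons A : measurable A -> measurable (cons_rV @^-1` A).
  by rewrite -[X in _ -> measurable X]setTI; exact: measurable_cons_rV.
apply: measure_semi_sigma_additive => [k||]; first exact: mcons.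
- apply/trivIsetP => i j _ _ ij; rewrite -preimage_setI.
  by move/trivIsetP : tF => -> //; rewrite preimage_set0.
- by rewrite -preimage_bigcup; exact: mcons.
Qed.

HB.instance Definition _ := isMeasure.Build _ _ _ lebesgue_cons
  lebesgue_cons0 lebesgue_cons_ge0 lebesgue_cons_sigma_additive.

Let lebesgue_cons_sigma_finite : sigma_finite setT lebesgue_cons.
Proof.
have /sigma_finiteP[F [FT ndF Ffin]] := sigma_finiteT (@lebesgue_measure R).
have /sigma_finiteP[G [GT ndG Gfin]] := sigma_finiteT m.
exists (fun k => uncons_rV @^-1` (F k `*` G k)).
  apply/seteqP; split => // v _.
  have [i _ Fi] : (\bigcup_i F i) (uncons_rV v).1 by rewrite -FT.
  have [j _ Gj] : (\bigcup_i G i) (uncons_rV v).2 by rewrite -GT.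
  exists (maxn i j) => //; split.
  - by move: Fi; exact/subsetPset/ndF/leq_maxl.
  - by move: Gj; exact/subsetPset/ndG/leq_maxr.
move=> k; have [mF Fk] := Ffin k; have [mG Gk] := Gfin k.
split.
  rewrite -[X in measurable X]setTI; apply: measurable_uncons_rV => //.
  exact: measurableX.
rewrite /lebesgue_cons /pushforward -comp_preimage.
rewrite (_ : uncons_rV \o cons_rV = id); last by apply/funext => p /=.
by rewrite preimage_id product_measure1E// lte_mul_pinfty// ge0_fin_numE.
Qed.

HB.instance Definition _ := Measure_isSigmaFinite.Build _ _ _ lebesgue_cons
  lebesgue_cons_sigma_finite.

End lebesgue_rV_step.

(* Lebesgue measure on R^n as the n-fold product of the Lebesgue measure on R;
   on the one-point space R^0 it is the unit mass. *)
Fixpoint lebesgue_rV (R : realType) (n : nat) :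
    {sigma_finite_measure set 'rV[R]_n -> \bar R} :=
  match n with
  | 0 => \d_(0 : 'rV[R]_0)
  | n'.+1 => lebesgue_cons (lebesgue_rV R n')
  end.

Lemma lebesgue_rV_box (R : realType) (n : nat) (A : 'I_n -> set R) :
  (forall i, measurable (A i)) ->
  lebesgue_rV R n [set v | forall i, A i (v ord0 i)] =
  (\prod_(i < n) lebesgue_measure (A i))%E.
Proof.
elim: n A => [|n IH] A mA; first by rewrite big_ord0 /= diracE mem_set// => -[].
rewrite big_ord_recl -IH//= /lebesgue_cons /pushforward.
set B := [set v : 'rV[R]_n | forall i, A (lift ord0 i) (v ord0 i)].
rewrite (_ : _ @^-1` _ = A ord0 `*` B); last first.
  have c0 (p : R * 'rV[R]_n) : cons_rV p ord0 ord0 = p.1.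
    transitivity (cons_rV p ord0 (lshift n (ord0 : 'I_1))).
      by congr (cons_rV _ _ _); exact/val_inj.
    by apply: etrans (row_mxEl _ _ _ _) _; rewrite mxE.
  have cS (p : R * 'rV[R]_n) i : cons_rV p ord0 (lift ord0 i) = p.2 ord0 i.
    transitivity (cons_rV p ord0 (rshift 1 i)).
      by congr (cons_rV _ _ _); exact/val_inj.
    exact: row_mxEr.
  apply/seteqP; split => [p /= pA|p [/= p0 pS] i].
    by split => [|i]; [rewrite -c0|rewrite /= -cS].
  by have [j ->|->] := unliftP ord0 i; rewrite ?cS ?c0.
suff mB : measurable B by rewrite product_measure1E; [|exact: mA|].
rewrite (_ : B = \bigcap_(i in [set: 'I_n])
    ((fun v : 'rV[R]_n => v ord0 i) @^-1` A (lift ord0 i))).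
  apply: fin_bigcap_measurable => // i _.
  by rewrite -[X in measurable X]setTI; apply: measurable_coord => //; exact: mA.
by apply/seteqP; split => v /= vB i; [move=> _|]; exact: vB.
Qed.

Section euclidean.
Context {R : realType} {n : nat}.
Implicit Types x y m a b : 'rV[R]_n.

Definition dotp x y : R := \sum_(i < n) x ord0 i * y ord0 i.

(* Not the norm `|x| of 'rV[R]_n, which is the sup norm. *)
Definition enorm x : R := Num.sqrt (dotp x x).

Definition angle x y : R := acos (dotp x y / (enorm x * enorm y)).

Definition segment a b : set 'rV[R]_n :=
  [set t *: a + (1 - t) *: b | t in `[0, 1]%classic].

Definition normal_pdf_rV m (s : R) x : R :=
  (2 * pi * s ^+ 2) `^ (- (n%:R / 2)) *
  expR (- (enorm (x - m) ^+ 2 / (2 * s ^+ 2))).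

Definition normal_rV m (s : R) : set 'rV[R]_n -> \bar R :=
  fun A => (\int[lebesgue_rV R n]_(x in A) (normal_pdf_rV m s x)%:E)%E.

(* The law of t a + (1 - t) b + eta, with t uniform on [0, 1] and eta an
   independent normal vector with mean 0 and variance s^2. *)
Definition noisy_segment a b (s : R) : set 'rV[R]_n -> \bar R :=
  pushforward (uniform_prob (@ltr01 R) \x normal_rV 0 s)%E
    (fun p : R * 'rV[R]_n => p.1 *: a + (1 - p.1) *: b + p.2).

End euclidean.

(* A finite loopless graph with N0 vertices and N1 edges, its vertices being
   placed in R^n; the orientation of the edges is only a matter of encoding. *)
Record placed_graph (R : realType) (n N0 N1 : nat) := PlacedGraph {
  vertex : 'I_N0 -> 'rV[R]_n ;
  ends : 'I_N1 -> 'I_N0 * 'I_N0 ;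
  ends_neq : forall e, (ends e).1 != (ends e).2
}.

Section placed_graph.
Context {R : realType} {n N0 N1 : nat} (G : placed_graph R n N0 N1).

Definition incident (u : 'I_N0) (e : 'I_N1) : bool :=
  (u == (ends G e).1) || (u == (ends G e).2).

Definition degree (u : 'I_N0) : nat := #|[set e | incident u e]%SET|.

Definition other_end (u : 'I_N0) (e : 'I_N1) : 'I_N0 :=
  if u == (ends G e).1 then (ends G e).2 else (ends G e).1.

Definition embedded_edge (e : 'I_N1) : set 'rV[R]_n :=
  segment (vertex G (ends G e).1) (vertex G (ends G e).2).

Definition edge_angle (u : 'I_N0) (e f : 'I_N1) : R :=
  angle (vertex G (other_end u e) - vertex G u)
        (vertex G (other_end u f) - vertex G u).

End placed_graph.

Record linear_graph (R : realType) (n N0 N1 : nat) := LinearGraph {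
  lg_graph :> placed_graph R n N0 N1 ;
  lg_vertex_inj : injective (vertex lg_graph) ;
  lg_edge_meet : forall e f, e != f ->
    embedded_edge lg_graph e `&` embedded_edge lg_graph f !=set0 ->
    exists u, [/\ incident lg_graph u e, incident lg_graph u f &
      embedded_edge lg_graph e `&` embedded_edge lg_graph f =
      [set vertex lg_graph u]] ;
  lg_angle : forall u e f, degree lg_graph u = 2%N -> e != f ->
    incident lg_graph u e -> incident lg_graph u f ->
    edge_angle lg_graph u e f != pi
}.

(* The strata are indexed by 'I_(N0 + N1): the vertices come first. *)
Section strata.
Context {R : realType} {n N0 N1 : nat} (G : linear_graph R n N0 N1).

Definition carrier : set 'rV[R]_n :=
  [set x | (exists u, x = vertex G u) \/ (exists e, embedded_edge G e x)].

(* The strata that are not in the boundary of another stratum. *)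
Definition top_stratum (i : 'I_(N0 + N1)) : Prop :=
  match fintype.split i with
  | inl u => forall e, ~~ incident G u e
  | inr _ => True
  end.

Definition stratum_law (s : R) (i : 'I_(N0 + N1)) : set 'rV[R]_n -> \bar R :=
  match fintype.split i with
  | inl u => normal_rV (vertex G u) s
  | inr e =>
    noisy_segment (vertex G (ends G e).1) (vertex G (ends G e).2) s
  end.

End strata.

Section independence.
Context d (T : measurableType d) (R : realType) (P : probability T R).

(* Meaningful only for P B != 0. *)
Definition cond_prob (A B : set T) : \bar R := (P (A `&` B) / P B)%E.

Definition independent (E F : set (set T)) : Prop :=
  forall A B, E A -> F B -> P (A `&` B) = (P A * P B)%E.

Definition mutually_independent (J : eqType) (E : J -> set (set T)) : Prop :=
  forall (js : seq J) (A : J -> set T), uniq js ->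
  (forall j, E j (A j)) ->
  P (\big[setI/setT]_(j <- js) A j) = (\prod_(j <- js) P (A j))%E.

End independence.

(* p is the vector of category probabilities, s the vector of noise parameters
   and J the set of data points. The sigma-algebra generated by a random element
   is the family of its preimages, every subset of the finite type of the Z j
   being measurable. That p is a probability vector is a consequence of
   gm_Z_categorical as soon as J is inhabited. *)
Record graph_mixture (R : realType) (n N0 N1 : nat)
    (G : linear_graph R n N0 N1)
    (p : 'I_(N0 + N1) -> R) (s : 'I_(N0 + N1) -> R)
    (d : measure_display) (T : measurableType d) (P : probability T R)
    (J : eqType) (X : J -> {RV P >-> 'rV[R]_n}) (Z : J -> T -> 'I_(N0 + N1)) :
    Prop := GraphMixture {
  gm_Z_measurable : forall j i, measurable (Z j @^-1` [set i]) ;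
  gm_Z_independent :
    mutually_independent P
      (fun j => preimage_set_system setT (Z j) discrete_measurable) ;
  gm_X_independent_X : forall i j, i != j ->
    independent P (preimage_set_system setT (X j) measurable)
                  (preimage_set_system setT (X i) measurable) ;
  gm_X_independent_Z : forall i j, i != j ->
    independent P (preimage_set_system setT (X j) measurable)
                  (preimage_set_system setT (Z i) discrete_measurable) ;
  gm_Z_categorical : forall j i, P (Z j @^-1` [set i]) = (p i)%:E ;
  gm_X_conditional : forall j i, (0 < P (Z j @^-1` [set i]))%E ->
    forall A, measurable A ->
    cond_prob P (X j @^-1` A) (Z j @^-1` [set i]) = stratum_law G (s i) i A
}.

Definition max_noise (R : realType) (N : nat) (s : 'I_N -> R) : R :=
  \big[Num.max/0]_(i < N) s i.

Definition equivalent_measures d (T : measurableType d) (R : realType)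
    (m1 m2 : set T -> \bar R) : Prop := m1 `<< m2 /\ m2 `<< m1.

Definition measure_support (R : realType) (n : nat)
    (m : set 'rV[R]_n -> \bar R) : set 'rV[R]_n :=
  [set x | forall U, open U -> U x -> (0 < m U)%E].

Definition weak_cvg (R : realType) (n : nat) (L : Type) (F : set_system L)
    (m : L -> set 'rV[R]_n -> \bar R) (m0 : set 'rV[R]_n -> \bar R) : Prop :=
  forall f : 'rV[R]_n -> R, continuous f -> bounded_fun f ->
  (\int[m l]_x (f x)%:E)%E @[l --> F] --> (\int[m0]_x (f x)%:E)%E.

(* Main.v *)
(** Seeing a vertex as the degenerate segment from it to itself, every stratum
    law is the law of [t a + (1 - t) b + eta], with [t] uniform on [0, 1] and
    [eta] normal: an average over [t] of normal laws, whose null sets are, the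
    densities being positive, the Lebesgue null sets. The points
    [t a + (1 - t) b + eta] and [t a + (1 - t) b] are at distance [|eta|] and a
    continuous function is uniformly continuous around the compact segment, so
    that, when the noise vanishes, the stratum law converges weakly to the law
    of [t a + (1 - t) b]. The limit of the model is the mixture of these laws
    with the category probabilities: it lives on the graph and charges every
    open set meeting a stratum of positive probability. *)

Require Import Defs.
From HB Require Import structures.
From mathcomp Require Import all_boot all_order all_algebra.
From mathcomp Require Import all_classical all_reals all_analysis.
From mathcomp Require Import measurable_realfun ring lra.

Set Implicit Arguments.
Unset Strict Implicit.
Unset Printing Implicit Defensive.

Import Order.TTheory GRing.Theory Num.Theory.
Import numFieldNormedType.Exports.

Local Open Scope classical_set_scope.
Local Open Scope ring_scope.

(** * Integration on R^n *)

Section lebesgue_rV.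
Context {R : realType}.

Lemma measurable_addr_rV n (c : 'rV[R]_n) :
  measurable_fun [set: 'rV[R]_n] (fun v : 'rV[R]_n => v + c).
Proof.
apply: measurable_fun_rV => i; under eq_fun do rewrite mxE.
by apply: measurable_funD => //; exact: measurable_coord.
Qed.

(** By uniqueness of Lebesgue measure: the push-forward along the translation gives a half-open
    interval the length of the shifted interval, which is the same. *)
Lemma lebesgue_measure_shift (c : R) (A : set (measurableTypeR R)) :
  measurable A ->
  lebesgue_measure ((fun x : measurableTypeR R => x + c) @^-1` A) =
  lebesgue_measure A.
Proof.
move=> mA.
have mc : measurable_fun [set: measurableTypeR R]
    (fun x => x + c : measurableTypeR R) by exact: measurable_funD.
apply/esym; apply: (@lebesgue_measure_unique R (pushforward lebesgue_measure
    (fun x : measurableTypeR R => x + c : measurableTypeR R))) => //.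
move=> _ [[a b] _ <-] /=.
rewrite /pushforward /=.
rewrite (_ : _ @^-1` _ = `]a - c, b - c]%classic); last first.
  by apply/seteqP; split => x /=; rewrite !in_itv /= ltrBlDr lerBrDr.
rewrite !lebesgue_measure_itv /= !lte_fin ltrD2r.
by case: ifP => // _; congr EFin; ring.
Qed.

Lemma ge0_integral_lebesgue_shift (c : R) (f : measurableTypeR R -> \bar R) :
  measurable_fun setT f -> (forall x, 0 <= f x)%E ->
  (\int[@lebesgue_measure R]_x f (x + c)%R = \int[@lebesgue_measure R]_x f x)%E.
Proof.
move=> mf f0.
have mc : measurable_fun [set: measurableTypeR R]
    (fun x => x + c : measurableTypeR R) by exact: measurable_funD.
transitivity (\int[pushforward (@lebesgue_measure R)
    (fun x : measurableTypeR R => x + c : measurableTypeR R)%R]_x f x)%E.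
  by rewrite (ge0_integral_pushforward mc).
apply: (eq_measure_integral lebesgue_measure) => A mA _.
exact: lebesgue_measure_shift.
Qed.

(** [lebesgue_rV] in dimension [n.+1] is by construction a push-forward of a product measure along
    [cons_rV], so a change of variables and Tonelli suffice. This is the induction step of the next
    results on R^n. *)
Lemma ge0_integral_lebesgue_rVS n (f : 'rV[R]_n.+1 -> \bar R) :
  measurable_fun setT f -> (forall v, 0 <= f v)%E ->
  (\int[lebesgue_rV R n.+1]_v f v =
   \int[@lebesgue_measure R]_x \int[lebesgue_rV R n]_v f (cons_rV (x, v)))%E.
Proof.
move=> mf f0; transitivity (\int[pushforward
    (@lebesgue_measure R \x lebesgue_rV R n)%E (@cons_rV R n)]_v f v)%E => //.
have mc : measurable_fun [set: measurableTypeR R * 'rV[R]_n] (@cons_rV R n).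
  exact: measurable_cons_rV.
rewrite (ge0_integral_pushforward mc)//= preimage_setT fubini_tonelli1 //=.
exact: measurableT_comp.
Qed.

Lemma cons_rV0 n (p : R * 'rV[R]_n) : cons_rV p ord0 ord0 = p.1.
Proof.
transitivity (cons_rV p ord0 (lshift n (ord0 : 'I_1))).
  by congr (cons_rV _ _ _); exact/val_inj.
by apply: etrans (row_mxEl _ _ _ _) _; rewrite mxE.
Qed.

Lemma cons_rVS n (p : R * 'rV[R]_n) i :
  cons_rV p ord0 (lift ord0 i) = p.2 ord0 i.
Proof.
transitivity (cons_rV p ord0 (rshift 1 i)).
  by congr (cons_rV _ _ _); exact/val_inj.
exact: row_mxEr.
Qed.

Lemma cons_rVD n (x : R) (v : 'rV[R]_n) (c : 'rV[R]_n.+1) :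
  cons_rV (x, v) + c =
  cons_rV (x + c ord0 ord0, v + \row_i c ord0 (lift ord0 i)).
Proof.
apply/rowP => i; rewrite mxE; have [j ->|->] := unliftP ord0 i.
  by rewrite !cons_rVS/= !mxE.
by rewrite !cons_rV0.
Qed.

Lemma measurable_cons_rVr n (x : R) :
  measurable_fun [set: 'rV[R]_n] (fun v : 'rV[R]_n => cons_rV (x, v)).
Proof.
apply: (measurableT_comp (@measurable_cons_rV R n)).
exact: measurable_fun_pair.
Qed.

(** Induction on the dimension: after splitting off the first coordinate, the induction hypothesis
    removes the shift of the others and the one-dimensional invariance removes the remaining one. *)
Lemma ge0_integral_lebesgue_rV_shift n (c : 'rV[R]_n) (f : 'rV[R]_n -> \bar R) :
  measurable_fun setT f -> (forall v, 0 <= f v)%E ->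
  (\int[lebesgue_rV R n]_v f (v + c)%R = \int[lebesgue_rV R n]_v f v)%E.
Proof.
elim: n c f => [|n IH] c f mf f0.
  by apply: eq_integral => v _; congr f; apply/rowP => -[].
rewrite !ge0_integral_lebesgue_rVS//; last first.
  by apply: measurableT_comp => //; exact: measurable_addr_rV.
set c' := \row_i c ord0 (lift ord0 i).
transitivity (\int[@lebesgue_measure R]_x \int[lebesgue_rV R n]_v
    f (cons_rV ((x + c ord0 ord0)%R, v)))%E.
  apply: eq_integral => x _.
  rewrite -(IH c' (fun v => f (cons_rV (x + c ord0 ord0, v))))//.
    by apply: eq_integral => v _; rewrite cons_rVD.
  by apply: measurableT_comp => //; exact: measurable_cons_rVr.
(* The inner integral, as a function of the first coordinate, is measurable by Tonelli;
   one-dimensional invariance then applies to it. *)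
pose g (x : measurableTypeR R) :=
  (\int[lebesgue_rV R n]_v f (cons_rV (x, v)))%E.
have mg : measurable_fun [set: measurableTypeR R] g.
  apply: (measurable_fun_fubini_tonelli_F (f \o @cons_rV R n)).
    by apply: measurableT_comp => //; exact: measurable_cons_rV.
  by move=> p; exact: f0.
have g0 x : (0 <= g x)%E by exact: integral_ge0.
have := ge0_integral_lebesgue_shift (c ord0 ord0) mg g0; exact.
Qed.

Lemma ge0_integral_lebesgue_rV_prod n (f : 'I_n -> R -> R) :
  (forall i, measurable_fun setT (f i)) -> (forall i x, 0 <= f i x) ->
  (\int[lebesgue_rV R n]_v (\prod_(i < n) f i (v ord0 i))%:E =
   \prod_(i < n) \int[@lebesgue_measure R]_x (f i x)%:E)%E.
Proof.
elim: n f => [|n IH] f mf f0.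
  under eq_integral do rewrite big_ord0.
  by rewrite big_ord0 (integral_cst _ measurableT) /= diracT mule1.
have mprod m (g : 'I_m -> R -> R) : (forall i, measurable_fun setT (g i)) ->
    measurable_fun setT (fun v : 'rV[R]_m => \prod_(i < m) g i (v ord0 i)).
  move=> mg; apply: measurable_prod => i _.
  exact: (measurableT_comp (mg i) (@measurable_coord R m i)).
rewrite (ge0_integral_lebesgue_rVS
  (f := fun v => (\prod_(i < n.+1) f i (v ord0 i))%:E)); last 2 first.
- by apply/measurable_EFinP; exact: (mprod n.+1 f).
- by move=> v; rewrite lee_fin prodr_ge0.
rewrite big_ord_recl -(IH (fun i => f (lift ord0 i)))//.
set g := fun v : 'rV[R]_n => \prod_(i < n) f (lift ord0 i) (v ord0 i).
have mg : measurable_fun setT g.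
  by apply: (mprod n (fun i => f (lift ord0 i))) => i; exact: mf.
have g0 v : 0 <= g v by rewrite prodr_ge0.
transitivity (\int[@lebesgue_measure R]_x
  ((f ord0 x)%:E * \int[lebesgue_rV R n]_v (g v)%:E))%E.
  apply: eq_integral => x _.
  have {}mg : measurable_fun setT (fun v => (g v)%:E) by exact/measurable_EFinP.
  have {}g0 v : [set: 'rV[R]_n] v -> (0 <= (g v)%:E)%E by rewrite lee_fin.
  have fx0 : (0 <= (f ord0 x)%:E)%E by rewrite lee_fin.
  rewrite -(ge0_integralZl _ measurableT mg g0 fx0).
  apply: eq_integral => v _; rewrite big_ord_recl cons_rV0 EFinM.
  by under eq_bigr do rewrite cons_rVS.
have mf0 : measurable_fun [set: measurableTypeR R] (fun x => (f ord0 x)%:E).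
  by apply/measurable_EFinP; exact: mf.
rewrite (ge0_integralZr _ measurableT mf0)// => [x _|].
  by rewrite lee_fin.
by apply: integral_ge0 => v _; rewrite lee_fin.
Qed.

End lebesgue_rV.

(** * Normal laws on R^n *)

Section normal.
Context {R : realType} {n : nat}.
Implicit Types (m x : 'rV[R]_n) (s : R).

Lemma enorm_sqr x : enorm x ^+ 2 = \sum_(i < n) x ord0 i ^+ 2.
Proof.
rewrite sqr_sqrtr; first by apply: eq_bigr => i _; rewrite expr2.
by apply: sumr_ge0 => i _; rewrite -expr2 sqr_ge0.
Qed.

(** The squared Euclidean norm is a sum over the coordinates, so its exponential factors.
    Normalisation in R^n thus reduces to dimension one. *)
Lemma normal_pdf_rVE m s x : s != 0 ->
  normal_pdf_rV m s x = \prod_(i < n) normal_pdf (m ord0 i) s (x ord0 i).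
Proof.
move=> s0; under eq_bigr do rewrite normal_pdfE//.
rewrite big_split /= prodr_const card_ord /normal_fun -expR_sum.
rewrite /normal_pdf_rV enorm_sqr; congr (_ * expR _); last first.
  rewrite mulr_suml -sumrN; apply: eq_bigr => i _.
  by rewrite !mxE mulNr -[(s ^+ 2 *+ 2)]mulr_natl.
have a0 : 0 <= 2 * pi * s ^+ 2 by rewrite mulr_ge0 ?sqr_ge0// mulr_ge0 ?pi_ge0.
rewrite powRN [n%:R / 2]mulrC powRrM powR12_sqrt// powR_mulrn ?sqrtr_ge0//.
rewrite /normal_peak exprVn; congr ((Num.sqrt _ ^+ _)^-1); ring.
Qed.

Lemma normal_pdf_rV_gt0 m s x : s != 0 -> 0 < normal_pdf_rV m s x.
Proof.
move=> s0; rewrite /normal_pdf_rV mulr_gt0 ?expR_gt0// powR_gt0//.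
by rewrite mulr_gt0 ?exprn_even_gt0// mulr_gt0 ?pi_gt0.
Qed.

Lemma normal_pdf_rV_ge0 m s x : 0 <= normal_pdf_rV m s x.
Proof. by rewrite /normal_pdf_rV mulr_ge0 ?expR_ge0 ?powR_ge0. Qed.

Lemma measurable_normal_pdf_rV m s :
  measurable_fun setT (normal_pdf_rV m s).
Proof.
apply: measurable_funM => //; apply: measurableT_comp => //.
under eq_fun do rewrite enorm_sqr.
apply: measurableT_comp => //; apply: measurable_funM => //.
apply: measurable_sum => i; apply: measurable_funX.
under eq_fun do rewrite !mxE.
by apply: measurable_funB => //; exact: measurable_coord.
Qed.

Lemma integral_normal_pdf_rV m s : s != 0 ->
  (\int[lebesgue_rV R n]_x (normal_pdf_rV m s x)%:E = 1)%E.
Proof.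
move=> s0; under eq_integral do rewrite normal_pdf_rVE//.
rewrite (@ge0_integral_lebesgue_rV_prod R n (fun i => normal_pdf (m ord0 i) s)).
- by rewrite big1// => i _; rewrite integral_normal_pdf.
- by move=> i; exact: measurable_normal_pdf.
- by move=> i x; exact: normal_pdf_ge0.
Qed.

(** The density depends on [x - m] only, and Lebesgue measure is translation invariant. *)
Lemma normal_rV_shift m c s (A : set 'rV[R]_n) : measurable A ->
  normal_rV m s ((fun y => y + c) @^-1` A) = normal_rV (m + c) s A.
Proof.
move=> mA; rewrite /normal_rV.
rewrite !(integral_mkcond _ (fun x => (normal_pdf_rV _ s x)%:E)).
set f := ((fun x => (normal_pdf_rV (m + c) s x)%:E) \_ A).
rewrite -(ge0_integral_lebesgue_rV_shift c (f := f)).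
- apply: eq_integral => x _; rewrite /f !patchE.
  rewrite (_ : (x \in _) = (x + c \in A)); last first.
    by apply/idP/idP => /set_mem ?; exact/mem_set.
  rewrite /normal_pdf_rV (_ : x + c - (m + c) = x - m)//.
  by apply/rowP => i; rewrite !mxE; ring.
- apply/(measurable_restrictT _ mA); apply: measurable_funTS.
  by apply/measurable_EFinP; exact: measurable_normal_pdf_rV.
- by move=> x; apply: erestrict_ge0 => y _; rewrite lee_fin normal_pdf_rV_ge0.
Qed.

Section gaussian.
Variables (m : 'rV[R]_n) (s : R) (s_neq0 : s != 0).

(* The proof argument lets unification find the probability structure. *)
Definition gaussian of s != 0 := normal_rV m s.

Let gaussian0 : gaussian s_neq0 set0 = 0%E.
Proof. exact: integral_set0. Qed.

Let gaussian_ge0 A : (0 <= gaussian s_neq0 A)%E.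
Proof. by apply: integral_ge0 => x _; rewrite lee_fin normal_pdf_rV_ge0. Qed.

Let gaussian_sigma_additive : semi_sigma_additive (gaussian s_neq0).
Proof.
move=> F mF tF mUF; rewrite /gaussian /normal_rV ge0_integral_bigcup//.
- by apply: is_cvg_ereal_nneg_natsum_cond => k _ _; exact: gaussian_ge0.
- apply: measurable_funTS; apply/measurable_EFinP.
  exact: measurable_normal_pdf_rV.
- by move=> x _; rewrite lee_fin normal_pdf_rV_ge0.
Qed.

HB.instance Definition _ := isMeasure.Build _ _ _ (gaussian s_neq0)
  gaussian0 gaussian_ge0 gaussian_sigma_additive.

Let gaussian_setT : gaussian s_neq0 setT = 1%E.
Proof. exact: integral_normal_pdf_rV. Qed.

HB.instance Definition _ := Measure_isProbability.Build _ _ _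
  (gaussian s_neq0) gaussian_setT.

(** A positive function has a vanishing integral over [A] only if [A] is null. In particular all
    these normal laws have the same null sets, whatever their mean and variance. *)
Lemma gaussian_eq0 A : measurable A ->
  gaussian s_neq0 A = 0%E <-> lebesgue_rV R n A = 0%E.
Proof.
have mpdf : measurable_fun A (fun x => (normal_pdf_rV m s x)%:E).
  apply: measurable_funTS; apply/measurable_EFinP.
  exact: measurable_normal_pdf_rV.
move=> mA; split => [g0|A0]; last exact: null_set_integral.
have /(ae_eq_integral_abs _ mA mpdf)[N [mN N0 AN]] :
    (\int[lebesgue_rV R n]_(x in A) `|(normal_pdf_rV m s x)%:E| = 0)%E.
  rewrite -[RHS]g0; apply: eq_integral => x _.
  by rewrite gee0_abs// lee_fin normal_pdf_rV_ge0.
(* [N] contains every point of [A] where the density is nonzero, that is, all of [A]. *)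
apply: (subset_measure0 mA mN _ N0) => x Ax; apply: AN => /= /(_ Ax)[] /eqP.
by rewrite gt_eqF// normal_pdf_rV_gt0.
Qed.

End gaussian.
End normal.

(** * Tails of the normal law *)

Section tail.
Context {R : realType} {n : nat}.
Implicit Types (y : 'rV[R]_n) (s r : R).

(** Links the sup norm, whose balls define the topology, to the Euclidean norm, in which the density
    is written. *)
Lemma normr_le_enorm y : `|y| <= enorm y.
Proof.
rewrite /Num.Def.normr /= mx_normrE; apply: bigmax_le; first exact: sqrtr_ge0.
move=> [i j] _ /=; rewrite ord1 -sqrtr_sqr ler_wsqrtr// /dotp (bigD1 j)//=.
by rewrite -expr2 lerDl sumr_ge0// => k _; rewrite -expr2 sqr_ge0.
Qed.

(* Outside the ball of radius [r] the density is compared with the one of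
   parameter [2 * s], so that no moment of the normal law is needed. *)
Lemma normal_pdf_rV_tail s r y : 0 < s -> 0 < r -> r <= `|y| ->
  normal_pdf_rV 0 s y <=
  4 `^ (n%:R / 2) * (4 * s ^+ 2 / r ^+ 2) * normal_pdf_rV 0 (2 * s) y.
Proof.
move=> s0 r0 ry; rewrite /normal_pdf_rV subr0.
have ss : 0 < s ^+ 2 by rewrite exprn_gt0.
have rr : 0 < r ^+ 2 by rewrite exprn_gt0.
set q := enorm y ^+ 2.
have rq : r ^+ 2 <= q.
  have re : r <= enorm y := le_trans ry (normr_le_enorm y).
  by rewrite /q ler_sqr ?nnegrE ?sqrtr_ge0 ?(ltW r0).
have -> : 2 * pi * (2 * s) ^+ 2 = 4 * (2 * pi * s ^+ 2) by ring.
have c0 : 0 <= 2 * pi * s ^+ 2 by rewrite mulr_ge0 ?ltW// mulr_gt0 ?pi_gt0.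
rewrite (powRM _ _ c0)// !powRN.
set c := (_ * s ^+ 2) `^ _; set k := 4 `^ _.
have k0 : 0 < k by rewrite powR_gt0.
have ci0 : 0 <= c^-1 by rewrite invr_ge0 powR_ge0.
rewrite (_ : _ * _ * (_ * _) = c^-1 *
   (4 * s ^+ 2 / r ^+ 2 * expR (- (q / (2 * (2 * s) ^+ 2))))); last first.
  by field; rewrite !gt_eqF//= powR_gt0// mulr_gt0// mulr_gt0 ?pi_gt0.
apply: ler_wpM2l => //.
(* As [2 * (2 * s) ^+ 2] is [8 * s ^+ 2], an excess of [3 * q / (8 * s ^+ 2)] remains. Since
   [r ^+ 2 <= q], the inequality [1 + u <= expR u] makes its exponential at least
   [r ^+ 2 / (4 * s ^+ 2)]. *)
rewrite (_ : - (q / (2 * s ^+ 2)) = - (3 * q / (8 * s ^+ 2)) +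
   - (q / (2 * (2 * s) ^+ 2))); last by field; rewrite gt_eqF.
rewrite expRD ler_wpM2r ?expR_ge0// expRN.
have u0 : 0 < r ^+ 2 / (4 * s ^+ 2) by rewrite divr_gt0// mulr_gt0.
rewrite (_ : 4 * s ^+ 2 / r ^+ 2 = (r ^+ 2 / (4 * s ^+ 2))^-1); last first.
  by rewrite invf_div.
rewrite lef_pV2 ?posrE ?expR_gt0//; apply: le_trans (expR_ge1Dx _).
rewrite ler_wpDl// ler_pdivrMr ?mulr_gt0//.
rewrite (_ : _ / _ * _ = 3 * q / 2); last by field; rewrite gt_eqF.
by nra.
Qed.

Lemma measurable_normr_ge r : measurable [set y : 'rV[R]_n | r <= `|y|].
Proof.
have := @continuous_measurable_rV_fun R n _ (@norm_continuous R 'rV[R]_n).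
move=> /(_ measurableT `[r, +oo[%classic (measurable_itv _)).
rewrite setTI; congr measurable.
by apply/seteqP; split => y /=; rewrite in_itv/= andbT.
Qed.

(** Integrate the pointwise comparison and enlarge the domain to the whole space, where the density
    of parameter [2 * s] has mass 1. The bound is of order [s ^+ 2] for fixed [r]. *)
Lemma gaussian_tail s (s_neq0 : s != 0) r : 0 < s -> 0 < r ->
  (gaussian 0 s_neq0 [set y : 'rV[R]_n | (r <= `|y|)%R] <=
   (4 `^ (n%:R / 2) * (4 * s ^+ 2 / r ^+ 2))%:E)%E.
Proof.
move=> s0 r0; set k := 4 `^ _ * _; rewrite /gaussian /normal_rV.
have k0 : 0 <= k.
  by rewrite mulr_ge0 ?powR_ge0// divr_ge0 ?mulr_ge0 ?exprn_ge0 ?ltW.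
have s20 : 2 * s != 0 by rewrite mulf_neq0.
have mpdf t D : measurable_fun D (fun x : 'rV[R]_n => (normal_pdf_rV 0 t x)%:E).
  apply: measurable_funTS; apply/measurable_EFinP.
  exact: measurable_normal_pdf_rV.
apply: (@le_trans _ _
    (\int[lebesgue_rV R n]_(y in [set y : 'rV[R]_n | (r <= `|y|)%R])
      (k%:E * (normal_pdf_rV 0 (2 * s) y)%:E))%E).
  apply: ge0_le_integral => //.
  - exact: measurable_normr_ge.
  - by move=> y _; rewrite lee_fin normal_pdf_rV_ge0.
  - exact: measurable_funeM.
  - by move=> y ry; rewrite -EFinM lee_fin; exact: normal_pdf_rV_tail.
rewrite ge0_integralZl//; last 2 first.
- exact: measurable_normr_ge.
- by move=> y _; rewrite lee_fin normal_pdf_rV_ge0.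
rewrite -[leRHS]mule1 lee_wpmul2l//.
rewrite -(integral_normal_pdf_rV (0 : 'rV[R]_n) s20).
apply: ge0_subset_integral => //; first exact: measurable_normr_ge.
by move=> y _; rewrite lee_fin normal_pdf_rV_ge0.
Qed.

End tail.

(** * Noisy segments *)

Section noisy.
Context {R : realType} {n : nat}.
Implicit Types (a b : 'rV[R]_n) (s : R).

Definition segment_point a b (t : measurableTypeR R) : 'rV[R]_n :=
  t *: a + (1 - t) *: b.

Lemma segment_pointxx a t : segment_point a a t = a.
Proof. by rewrite /segment_point -scalerDl addrC subrK scale1r. Qed.

Lemma continuous_segment_point a b :
  continuous (segment_point a b : R -> 'rV[R]_n).
Proof.
move=> t; apply: cvgD; apply: cvgZr_tmp; first exact: cvg_id.
by apply: cvgB; [exact: cvg_cst|exact: cvg_id].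
Qed.

Lemma measurable_segment_point a b : measurable_fun setT (segment_point a b).
Proof.
apply: measurable_fun_rV => i; rewrite /segment_point.
under eq_fun do rewrite !mxE.
by apply: measurable_funD; apply: measurable_funM => //; exact: measurable_funB.
Qed.

HB.instance Definition _ a b :=
  isMeasurableFun.Build _ _ _ _ (segment_point a b)
    (measurable_segment_point a b).

Definition noisy_point a b (p : measurableTypeR R * 'rV[R]_n) : 'rV[R]_n :=
  segment_point a b p.1 + p.2.

Lemma measurable_noisy_point a b : measurable_fun setT (noisy_point a b).
Proof.
apply: measurable_fun_rV => i; rewrite /noisy_point.
under eq_fun do rewrite mxE.
apply: measurable_funD.
  apply: (measurableT_comp (measurable_coord i)).
  by apply: (measurableT_comp (measurable_segment_point a b)).
by apply: (measurableT_comp (measurable_coord i)).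
Qed.

HB.instance Definition _ a b :=
  isMeasurableFun.Build _ _ _ _ (noisy_point a b) (measurable_noisy_point a b).

Section segment_noise.
Variables (s : R) (s_neq0 : s != 0).

Definition segment_noise : set (measurableTypeR R * 'rV[R]_n) -> \bar R :=
  (uniform_prob (@ltr01 R) \x gaussian 0 s_neq0)%E.

HB.instance Definition _ := Measure.on segment_noise.

Let segment_noise_setT : segment_noise setT = 1%E.
Proof.
rewrite /segment_noise -setXTT product_measure1E//.
by rewrite [X in (X * _)%E]probability_setT mul1e [LHS]probability_setT.
Qed.

HB.instance Definition _ := Measure_isProbability.Build _ _ _
  segment_noise segment_noise_setT.

Lemma segment_noiseX (A : set (measurableTypeR R)) (B : set 'rV[R]_n) :
  measurable A -> measurable B ->
  segment_noise (A `*` B) =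
  (uniform_prob (@ltr01 R) A * gaussian 0 s_neq0 B)%E.
Proof. exact: product_measure1E. Qed.

(** True by conversion; it lets the noisy law inherit the probability structure of
    [distribution]. *)
Lemma noisy_segmentE a b :
  noisy_segment a b s = distribution segment_noise (noisy_point a b).
Proof. by []. Qed.

Lemma gaussian_xsection a b (A : set 'rV[R]_n) t : measurable A ->
  gaussian 0 s_neq0 (xsection (noisy_point a b @^-1` A) t) =
  gaussian (segment_point a b t) s_neq0 A.
Proof.
move=> mA; rewrite /gaussian -[segment_point a b t]add0r -normal_rV_shift//.
by congr normal_rV; apply/seteqP; split => y; rewrite /xsection /= inE /= addrC.
Qed.

(** The product measure integrates the masses of sections, and the section at [t] is a translate of
    [A]: its centred normal mass is the mass of [A] under the normal law centred at the point of
    parameter [t]. *)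
Lemma noisy_segment_integral a b (A : set 'rV[R]_n) : measurable A ->
  noisy_segment a b s A =
  (\int[uniform_prob (@ltr01 R)]_t gaussian (segment_point a b t) s_neq0 A)%E.
Proof. by move=> mA; apply: eq_integral => t _; exact: gaussian_xsection. Qed.

Lemma noisy_segmentxx a (A : set 'rV[R]_n) : measurable A ->
  noisy_segment a a s A = normal_rV a s A.
Proof.
move=> mA; rewrite noisy_segment_integral//.
under eq_integral do rewrite segment_pointxx.
by rewrite integral_cst// [X in (_ * X)%E]probability_setT mule1.
Qed.

(** If the average over [t] vanishes, then so does the normal mass of [A] for some [t], and a single
    normal law determines the Lebesgue null sets. *)
Lemma noisy_segment_eq0 a b (A : set 'rV[R]_n) : measurable A ->
  noisy_segment a b s A = 0%E <-> lebesgue_rV R n A = 0%E.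
Proof.
move=> mA; rewrite noisy_segment_integral//; split => [i0|A0]; last first.
  by apply: integral0_eq => t _; apply/gaussian_eq0.
have mB : measurable (noisy_point a b @^-1` A).
  by rewrite -[X in measurable X]setTI; exact: measurable_noisy_point.
have mg : measurable_fun setT
    (fun t => gaussian (segment_point a b t) s_neq0 A).
  under eq_fun do rewrite -(gaussian_xsection _ _ _ mA).
  exact: (measurable_fun_xsection (gaussian 0 s_neq0)).
have /(ae_eq_integral_abs _ measurableT mg)[N [mN N0 AN]] :
    (\int[uniform_prob (@ltr01 R)]_t
       `|gaussian (segment_point a b t) s_neq0 A| = 0)%E.
  by rewrite -[RHS]i0; apply: eq_integral => t _; rewrite gee0_abs.
(* The exceptional set is null for a probability, so it is not the whole line. *)
have [t Nt] : exists t, ~ N t.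
  apply/existsNP => NT; have /eqP := N0.
  rewrite (_ : N = setT); last by apply/seteqP; split => // t _; exact: NT.
  by rewrite [X in X == _]probability_setT gt_eqF// lte01.
apply/(gaussian_eq0 (segment_point a b t) s_neq0 mA).
by apply: contrapT => gt0; apply: Nt; apply: AN => /= /(_ Logic.I).
Qed.

End segment_noise.
End noisy.

(** * Mixtures *)

Section bounded.
Context d (T : measurableType d) (R : realType) (P : probability T R).
Implicit Types (f g : T -> R) (M : R).

Lemma bounded_integrable f M : measurable_fun setT f ->
  (forall x, `|f x| <= M) -> P.-integrable setT (EFin \o f).
Proof.
move=> mf fM; apply: measurable_bounded_integrable => //.
  by rewrite [ltLHS]probability_setT ltry.
exists M; split=> [|K MK x _ /=]; first exact: num_real.
exact: le_trans (fM x) (ltW MK).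
Qed.

Lemma bounded_integralE f M : measurable_fun setT f ->
  (forall x, `|f x| <= M) -> (\int[P]_x (f x)%:E)%E = (\int[P]_x f x)%:E.
Proof.
move=> mf fM; rewrite /Rintegral fineK//.
by apply: integrable_fin_num => //; exact: bounded_integrable fM.
Qed.

Lemma Rintegral_addr f M c : measurable_fun setT f ->
  (forall x, `|f x| <= M) -> \int[P]_x (f x + c) = \int[P]_x f x + c.
Proof.
move=> mf fM; rewrite RintegralD//.
- by rewrite Rintegral_cst// [X in fine X]probability_setT mulr1.
- exact: bounded_integrable fM.
- exact: (@bounded_integrable (cst c) `|c|).
Qed.

(** The integrand is dominated by [e + 2 * M * \1_B]: [e] serves off the bad set [B], the crude
    bound [2 * M] on it. *)
Lemma Rintegral_diff_le f g M (e : R) (B : set T) :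
  measurable_fun setT f -> measurable_fun setT g -> measurable B ->
  (forall x, `|f x| <= M) -> (forall x, `|g x| <= M) -> 0 <= e ->
  (forall x, ~ B x -> `|f x - g x| <= e) ->
  `|\int[P]_x f x - \int[P]_x g x| <= e + 2 * M * fine (P B).
Proof.
move=> mf mg mB fM gM e0 fge.
have fgM x : `|f x - g x| <= 2 * M.
  by rewrite (le_trans (ler_normB _ _))// mulr2n mulrDl !mul1r lerD.
have M0 : 0 <= 2 * M by exact: le_trans (fgM point).
rewrite -RintegralB//;
  [|exact: bounded_integrable fM|exact: bounded_integrable gM].
have mfg : measurable_fun setT (fun x => f x - g x) by exact: measurable_funB.
have ifg := bounded_integrable mfg fgM.
apply: (le_trans (le_normr_Rintegral measurableT ifg)).
have i1 c : P.-integrable setT (EFin \o (fun x => c * \1_B x)).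
  apply: (@bounded_integrable _ `|c|); first exact: measurable_funM.
  move=> x; rewrite indicE normrM.
  by case: (_ \in _); rewrite ?(normr1, normr0, mulr1, mulr0).
have icst : P.-integrable setT (EFin \o cst e).
  exact: (@bounded_integrable (cst e) `|e|).
apply: (@le_trans _ _ (\int[P]_x (e + 2 * M * \1_B x))).
  apply: le_Rintegral => //.
  - apply: (@bounded_integrable _ (2 * M)); first exact: measurableT_comp.
    by move=> x; rewrite normr_id.
  - apply: (@bounded_integrable _ (e + 2 * M)).
      by apply: measurable_funD => //; exact: measurable_funM.
    move=> x; rewrite ger0_norm; last by rewrite addr_ge0// mulr_ge0.
    by rewrite lerD2l ler_piMr// indicE; case: (_ \in _).
  - move=> x _; rewrite indicE; case: (pselect (B x)) => Bx.
      by rewrite mem_set// mulr1 (le_trans (fgM x))// lerDr.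
    by rewrite memNset// mulr0 addr0 fge.
rewrite RintegralD// Rintegral_cst// [X in fine X]probability_setT mulr1.
rewrite RintegralZl//.
  by rewrite /Rintegral integral_indic// setIT.
by have := i1 1; under [X in EFin \o X]eq_fun do rewrite mul1r.
Qed.

End bounded.

Section mixture.
Context d (T : measurableType d) (R : realType) (N : nat).
Variables (w : 'I_N -> R) (w_ge0 : forall i, 0 <= w i).
Variables (w_sum1 : \sum_(i < N) w i = 1) (m : 'I_N -> probability T R).

(** [msum] sums a sequence of measures indexed by [nat]; the family over ['I_N] is extended by the
    zero measure. *)
Let part (k : nat) : {measure set T -> \bar R} :=
  if insub k is Some i then mscale (NngNum (w_ge0 i)) (m i) else mzero.

(* As for [gaussian], the proof argument is there for unification. *)
Definition mixture of \sum_(i < N) w i = 1 : set T -> \bar R := msum part N.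

HB.instance Definition _ := Measure.on (mixture w_sum1).

Lemma mixtureE A : mixture w_sum1 A = (\sum_(i < N) (w i)%:E * m i A)%E.
Proof.
by apply: eq_bigr => i _; rewrite /part valK.
Qed.

Let mixture_setT : mixture w_sum1 setT = 1%E.
Proof.
rewrite mixtureE; under eq_bigr do rewrite probability_setT mule1.
by rewrite sumEFin w_sum1.
Qed.

HB.instance Definition _ := Measure_isProbability.Build _ _ _
  (mixture w_sum1) mixture_setT.

Lemma ge0_integral_mixture (f : T -> \bar R) :
  measurable_fun setT f -> (forall x, 0 <= f x)%E ->
  (\int[mixture w_sum1]_x f x = \sum_(i < N) (w i)%:E * \int[m i]_x f x)%E.
Proof.
move=> mf f0; rewrite ge0_integral_measure_sum//; apply: eq_bigr => i _.
by rewrite /part valK ge0_integral_mscale.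
Qed.

(** The formula for nonnegative functions is applied to [f + M]; the constant [M] then cancels
    because the weights sum to 1. *)
Lemma Rintegral_mixture (f : T -> R) (M : R) :
  measurable_fun setT f -> (forall x, `|f x| <= M) ->
  \int[mixture w_sum1]_x f x = \sum_(i < N) w i * \int[m i]_x f x.
Proof.
move=> mf fM.
have mfM : measurable_fun setT (fun x => f x + M) by exact: measurable_funD.
have M0 : 0 <= M by exact: le_trans (fM point).
have fMM x : `|f x + M| <= M + M.
  by rewrite (le_trans (ler_normD _ _))// lerD// ger0_norm.
have fM0 x : (0 <= (f x + M)%:E)%E.
  by rewrite lee_fin -lerBlDr sub0r; have := fM x; rewrite ler_norml => /andP[].
apply: (addIr M); rewrite -(Rintegral_addr _ _ mf fM); apply: EFin_inj.
rewrite -(bounded_integralE _ mfM fMM) ge0_integral_mixture//; last first.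
  exact/measurable_EFinP.
under eq_bigr => i _ do
  rewrite (bounded_integralE _ mfM fMM) (Rintegral_addr _ _ mf fM) -EFinM
    mulrDr.
by rewrite sumEFin big_split /= -mulr_suml w_sum1 mul1r.
Qed.

End mixture.

(** * Vanishing noise *)

Section segment_law.
Context {R : realType} {n : nat}.
Implicit Types (a b : 'rV[R]_n) (s : R).

Definition segment_law a b : probability 'rV[R]_n R :=
  distribution (uniform_prob (@ltr01 R)) (segment_point a b).

Lemma uniform_prob01E (A : set (measurableTypeR R)) : measurable A ->
  uniform_prob (@ltr01 R) A = lebesgue_measure (A `&` `[0, 1]%classic).
Proof.
move=> mA; rewrite /uniform_prob integral_uniform_pdf.
rewrite (eq_integral (fun=> 1%E)); last first.
  move=> x; rewrite inE/= in_itv/= /uniform_pdf => -[_ ->].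
  by rewrite subr0 invr1.
by rewrite integral_cst ?mul1e//; exact: measurableI.
Qed.

Lemma uniform_prob01_open_gt0 (O : set R) t : open O -> O t -> 0 <= t <= 1 ->
  (0 < uniform_prob (@ltr01 R) O)%E.
Proof.
move=> oO Ot /andP[t0 t1].
have mO : measurable O by exact: open_measurable.
have /nbhs_ballP[e /= e0 teO] := open_nbhs_nbhs (conj oO Ot).
(* Half the radius keeps the closed interval inside the open ball. Cut down to [0, 1], it stays
   nondegenerate even when [t] is 0 or 1. *)
pose c := Num.max 0 (t - e / 2); pose d := Num.min 1 (t + e / 2).
have cd : c < d.
  by rewrite /c /d gt_max !lt_min; apply/andP; split; apply/andP; split; lra.
rewrite uniform_prob01E//.
apply: (@lt_le_trans _ _
    (lebesgue_measure (`[c, d]%classic : set (measurableTypeR R)))).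
  by rewrite lebesgue_measure_itv/= lte_fin cd -EFinD lte_fin subr_gt0.
apply: le_measure; rewrite ?inE//; first exact: measurableI.
move=> x; rewrite /= in_itv/= ge_max le_min => /andP[/andP[x0 tx] /andP[x1 xt]].
split; last by rewrite in_itv/= x0.
by apply: teO; rewrite /ball /= ltr_norml; apply/andP; split; lra.
Qed.

Lemma segmentE a b :
  segment a b = segment_point a b @` (`[0, 1]%classic : set R).
Proof. by []. Qed.

Lemma segment_leftP a b : segment a b a.
Proof.
by exists 1; rewrite ?scale1r ?subrr ?scale0r ?addr0//= in_itv/= lexx ler01.
Qed.

Lemma segment_rightP a b : segment a b b.
Proof.
by exists 0; rewrite ?scale0r ?subr0 ?scale1r ?add0r//= in_itv/= lexx ler01.
Qed.

Lemma segmentxx a : segment a a = [set a].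
Proof.
apply/seteqP; split => [_ [t _ <-]|_ ->]; first exact: segment_pointxx.
exact: segment_leftP.
Qed.

Lemma closed_segment a b : closed (segment a b).
Proof.
apply: compact_closed; first exact: norm_hausdorff.
rewrite segmentE; apply: continuous_compact; last exact: segment_compact.
by apply: continuous_subspaceT; exact: continuous_segment_point.
Qed.

Lemma uniform_prob01_itv : uniform_prob (@ltr01 R) `[0, 1]%classic = 1%E.
Proof.
rewrite uniform_prob01E// setIid lebesgue_measure_itv/=.
by rewrite lte_fin ltr01 oppr0 adde0.
Qed.

Lemma segment_law_full a b (A : set 'rV[R]_n) : measurable A ->
  segment a b `<=` A -> segment_law a b A = 1%E.
Proof.
move=> mA abA; apply/eqP; rewrite eq_le probability_le1//=.
rewrite -uniform_prob01_itv; apply: le_measure; rewrite ?inE//.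
  by rewrite -[X in measurable X]setTI; exact: measurable_segment_point.
by move=> t t01; apply: abA; exists t.
Qed.

Lemma segment_law_open_gt0 a b (U : set 'rV[R]_n) x : open U -> U x ->
  segment a b x -> (0 < segment_law a b U)%E.
Proof.
move=> oU Ux [t]; rewrite /= in_itv/= => t01 tx.
apply: (uniform_prob01_open_gt0 (t := t)) => //; last first.
  by rewrite /= /segment_point tx.
by apply: open_comp => // y _; exact: continuous_segment_point.
Qed.

(** The increment of [f] is jointly continuous at every [(t, 0)]; the near-covering form of the
    compactness of [0, 1] turns these local estimates into one radius valid for all [t]. *)
Lemma segment_uniform_continuous a b (f : 'rV[R]_n -> R) (e : R) :
  continuous f -> 0 < e ->
  exists2 r, 0 < r & forall t y, 0 <= t <= 1 -> `|y| < r ->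
    `|f (segment_point a b t + y) - f (segment_point a b t)| <= e.
Proof.
move=> cf e0.
have cg (t : R) : (fun p : R * 'rV[R]_n =>
    f (segment_point a b p.1 + p.2) - f (segment_point a b p.1)) p
    @[p --> (t, (0 : 'rV[R]_n))] --> 0.
  have c1 : segment_point a b p.1 @[p --> (t, (0 : 'rV[R]_n))] -->
      segment_point a b t.
    by apply: continuous_cvg; [exact: continuous_segment_point|exact: cvg_fst].
  rewrite -(subrr (f (segment_point a b t))) -{1}[segment_point a b t]addr0.
  apply: cvgB; last by apply: continuous_cvg => //; exact: cf.
  by apply: continuous_cvg; [exact: cf|apply: cvgD => //; exact: cvg_snd].
have /compact_near_coveringP cover01 := @segment_compact R 0 1.
have /nbhs_ballP[r /= r0 ball_r] : nbhs (0 : 'rV[R]_n) (fun y =>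
    `[0, 1]%classic `<=` (fun t : R =>
      `|f (segment_point a b t + y) - f (segment_point a b t)| <= e)).
  apply: (cover01 _ (nbhs (0 : 'rV[R]_n)) (fun y t =>
    `|f (segment_point a b t + y) - f (segment_point a b t)| <= e) _) => t _.
  have /cvgr_dist_le /(_ _ e0) := cg t.
  by apply: filterS => -[t' y] /=; rewrite sub0r normrN.
exists r => // t y t01 yr.
apply: ball_r; first by rewrite -ball_normE /ball_ /= sub0r normrN.
by rewrite /= in_itv.
Qed.

Definition clean_point a b (p : measurableTypeR R * 'rV[R]_n) : 'rV[R]_n :=
  segment_point a b p.1.

Lemma measurable_clean_point a b : measurable_fun setT (clean_point a b).
Proof. exact: (measurableT_comp (measurable_segment_point a b)). Qed.

HB.instance Definition _ a b :=
  isMeasurableFun.Build _ _ _ _ (clean_point a b) (measurable_clean_point a b).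

(* [clean_point] and [noisy_point] share the parameter [t]: this is the coupling
   of the limit law with the noisy law. *)
Lemma segment_law_clean a b s (s_neq0 : s != 0) (A : set 'rV[R]_n) :
  measurable A ->
  segment_law a b A = distribution (segment_noise s_neq0) (clean_point a b) A.
Proof.
move=> mA; rewrite /segment_law /distribution /pushforward.
have -> : clean_point a b @^-1` A = (segment_point a b @^-1` A) `*` setT.
  by apply/seteqP; split => p //= [].
rewrite [RHS]segment_noiseX//.
  by rewrite [X in (_ * X)%E]probability_setT mule1.
by rewrite -[X in measurable X]setTI; exact: measurable_segment_point.
Qed.

Lemma Rintegral_distribution d (T : measurableType d) (P : probability T R)
    (X : {RV P >-> 'rV[R]_n}) (f : 'rV[R]_n -> R) (M : R) :
  measurable_fun setT f -> (forall x, `|f x| <= M) ->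
  \int[distribution P X]_x f x = \int[P]_x f (X x).
Proof.
move=> mf fM; rewrite /Rintegral integral_distribution//.
- exact/measurable_EFinP.
- apply: (@bounded_integrable _ _ _ P (f \o X) M) => //.
    exact: measurableT_comp.
  by move=> x; exact: fM.
Qed.

(** Under the coupling, the two values of [f] differ by at most [e / 2] unless the noise exceeds the
    radius of uniform continuity, an event of probability of order [s ^+ 2]. *)
Lemma noisy_segment_cvg a b (f : 'rV[R]_n -> R) (M e : R) :
  continuous f -> (forall x, `|f x| <= M) -> 0 < e ->
  exists2 r, 0 < r & forall s (s_neq0 : s != 0), 0 < s -> s < r ->
    `|\int[segment_law a b]_x f x -
      \int[distribution (segment_noise s_neq0) (noisy_point a b)]_x f x| <= e.
Proof.
move=> cf fM e0; have M0 : 0 <= M by exact: le_trans (fM 0).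
have mf := continuous_measurable_rV_fun cf.
have [r r0 fr] := segment_uniform_continuous a b cf (divr_gt0 e0 (ltr0n _ 2)).
(* [K * s ^+ 2] is [2 * M] times the tail bound. For [s] below 1 it is at most [K * s], which the
   second term of the threshold keeps below [e / 2]; [K + 1] avoids dividing by zero. *)
pose K := 2 * M * (4 `^ (n%:R / 2) * (4 / r ^+ 2)).
have K0 : 0 <= K.
  have c0 : 0 <= 4 / r ^+ 2 by rewrite divr_ge0// sqr_ge0.
  by rewrite /K mulr_ge0// mulr_ge0// powR_ge0.
exists (Num.min 1 (e / (2 * (K + 1)))).
  by rewrite lt_min ltr01 divr_gt0// mulr_gt0// ltr_wpDl.
move=> s sn0 s0; rewrite lt_min => /andP[s1 se].
have -> : \int[segment_law a b]_x f x =
    \int[distribution (segment_noise sn0) (clean_point a b)]_x f x.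
  congr fine; apply: eq_measure_integral => A mA _.
  exact: segment_law_clean.
rewrite !(Rintegral_distribution _ mf fM).
pose tail := [set y : 'rV[R]_n | r <= `|y|].
have mtail : measurable tail := measurable_normr_ge r.
(* The estimate on [f] holds for [t] in [0, 1] only; this restriction on [t] costs no mass. *)
pose good := (`[0, 1]%classic : set (measurableTypeR R)) `*` ~` tail.
have mgood : measurable good.
  by apply: measurableX => //; exact: measurableC.
have badE : segment_noise sn0 (~` good) = gaussian 0 sn0 tail.
  rewrite probability_setC// [X in (1 - X)%E]segment_noiseX//; last first.
    exact: measurableC.
  rewrite uniform_prob01_itv mul1e [X in (_ - X)%E]probability_setC//.
  by rewrite oppeB ?fin_num_adde_defr// addeA subee// add0e.
apply: le_trans.
  apply: (@Rintegral_diff_le _ _ _ (segment_noise sn0) _ _ M (e / 2) (~` good)).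
  - exact: measurableT_comp.
  - exact: measurableT_comp.
  - exact: measurableC.
  - by move=> p; exact: fM.
  - by move=> p; exact: fM.
  - by rewrite divr_ge0 ?ltW.
  - move=> [t y] /contrapT[/=]; rewrite in_itv/= => t01 /negP.
    by rewrite -ltNge => yr; rewrite distrC; exact: fr.
rewrite [X in fine X]badE; have tail_le := gaussian_tail sn0 s0 r0.
have tail_fin : fine (gaussian 0 sn0 tail) <=
    4 `^ (n%:R / 2) * (4 * s ^+ 2 / r ^+ 2).
  by rewrite -lee_fin fineK// fin_num_measure.
rewrite {2}(splitr e) lerD2l.
apply: (@le_trans _ _ (2 * M * (4 `^ (n%:R / 2) * (4 * s ^+ 2 / r ^+ 2)))).
  by rewrite ler_wpM2l// mulr_ge0.
rewrite (_ : _ * (_ * _) = K * s ^+ 2); last by rewrite /K; ring.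
have {}se : s * (2 * (K + 1)) < e by rewrite -ltr_pdivlMr// mulr_gt0// ltr_wpDl.
have ss : s ^+ 2 <= s by rewrite expr2 ler_piMr// ltW.
have := ler_wpM2l K0 ss; nra.
Qed.

End segment_law.

(** * The graph mixture model *)

Section strata.
Context {R : realType} {n N0 N1 : nat} (G : linear_graph R n N0 N1).
Implicit Types i : 'I_(N0 + N1).

Definition stratum_ends i : 'rV[R]_n * 'rV[R]_n :=
  match fintype.split i with
  | inl u => (vertex G u, vertex G u)
  | inr e => (vertex G (ends G e).1, vertex G (ends G e).2)
  end.

Definition stratum i : set 'rV[R]_n :=
  segment (stratum_ends i).1 (stratum_ends i).2.

Lemma stratum_lawE s (s_neq0 : s != 0) i (A : set 'rV[R]_n) : measurable A ->
  stratum_law G s i A =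
  noisy_segment (stratum_ends i).1 (stratum_ends i).2 s A.
Proof.
move=> mA; rewrite /stratum_law /stratum_ends.
by case: fintype.split => //= u; rewrite noisy_segmentxx.
Qed.

Lemma stratum_vertex u : stratum (unsplit (inl u)) = [set vertex G u].
Proof. by rewrite /stratum /stratum_ends unsplitK segmentxx. Qed.

Lemma stratum_edge e : stratum (unsplit (inr e)) = embedded_edge G e.
Proof. by rewrite /stratum /stratum_ends unsplitK. Qed.

Lemma carrierE : carrier G = \bigcup_i stratum i.
Proof.
apply/seteqP; split => [x [[u ->]|[e ex]]|x [i _]].
- by exists (unsplit (inl u)) => //; rewrite stratum_vertex.
- by exists (unsplit (inr e)) => //; rewrite stratum_edge.
- rewrite -(splitK i); case: fintype.split => k.
    by rewrite stratum_vertex => ->; left; exists k.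
  by rewrite stratum_edge => kx; right; exists k.
Qed.

(** A vertex with an incident edge already lies on that edge, so edges and isolated vertices cover
    the graph. Hence positive weights on the top strata are enough to obtain full support. *)
Lemma carrier_top x : carrier G x -> exists2 i, top_stratum G i & stratum i x.
Proof.
move=> [[u ->]|[e ex]]; last first.
  by exists (unsplit (inr e)); rewrite ?stratum_edge// /top_stratum unsplitK.
have [[e ue]|ue] := pselect (exists e, incident G u e).
  exists (unsplit (inr e)); first by rewrite /top_stratum unsplitK.
  rewrite stratum_edge /embedded_edge.
  by case/orP: ue => /eqP ->; [exact: segment_leftP|exact: segment_rightP].
exists (unsplit (inl u)); last by rewrite stratum_vertex.
by rewrite /top_stratum unsplitK => e; apply/negP => ?; apply: ue; exists e.
Qed.

Lemma closed_carrier : closed (carrier G).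
Proof.
rewrite carrierE; apply: closed_bigcup => [|i _]; first exact: finite_finset.
exact: closed_segment.
Qed.

Lemma measurable_carrier : measurable (carrier G).
Proof.
rewrite -[carrier G]setCK; apply: measurableC; apply: open_measurable_rV.
exact/closed_openC/closed_carrier.
Qed.

End strata.

Lemma le_sume_nneg (R : realDomainType) (I : finType) (f : I -> \bar R)
    (i : I) :
  (forall k, 0 <= f k)%E -> (f i <= \sum_k f k)%E.
Proof. by move=> f0; rewrite (bigD1 i)//= leeDl// sume_ge0. Qed.

(** * The law of a data point *)

Section model.
Context {R : realType} {n N0 N1 : nat} {G : linear_graph R n N0 N1}
  {p s : 'I_(N0 + N1) -> R} {d : measure_display} {T : measurableType d}
  {P : probability T R} {J : eqType}
  {X : J -> {RV P >-> 'rV[R]_n}} {Z : J -> T -> 'I_(N0 + N1)}.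
Hypothesis model : graph_mixture G p s X Z.
Variable j : J.

Lemma category_ge0 i : 0 <= p i.
Proof. by rewrite -lee_fin -(gm_Z_categorical model j i). Qed.

Lemma total_probability A : measurable A ->
  P A = (\sum_(i < N0 + N1) P (A `&` Z j @^-1` [set i]))%E.
Proof.
move=> mA.
have mAZ i : measurable (A `&` Z j @^-1` [set i]).
  by apply: measurableI => //; exact: gm_Z_measurable model j i.
rewrite -(measure_bigsetU_ord P xpredT mAZ); last first.
  by move=> i i' _ _ [x [[_ <-] [_ <-]]].
congr (P _); rewrite -bigcup_seq; apply/seteqP; split => [x Ax|x [i _ []]//].
by exists (Z j x) => //=; exact: mem_index_enum.
Qed.

Lemma category_sum1 : \sum_(i < N0 + N1) p i = 1.
Proof.
apply: EFin_inj; rewrite -sumEFin -(probability_setT P) total_probability//.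
by apply: eq_bigr => i _; rewrite setTI (gm_Z_categorical model j i).
Qed.

(** Total probability over the values of [Z j], each conditional law being a stratum law. *)
Lemma model_lawE (s_gt0 : forall i, 0 < s i) A : measurable A ->
  distribution P (X j) A =
  (\sum_(i < N0 + N1) (p i)%:E *
     noisy_segment (stratum_ends G i).1 (stratum_ends G i).2 (s i) A)%E.
Proof.
move=> mA; rewrite /distribution /pushforward.
have mXA : measurable (X j @^-1` A).
  by rewrite -[X in measurable X]setTI; exact: measurable_funPT.
rewrite total_probability//; apply: eq_bigr => i _.
have Pi := gm_Z_categorical model j i.
rewrite -(stratum_lawE _ (lt0r_neq0 (s_gt0 i)))//.
(* The model says nothing about conditioning on a category of probability 0, but then both terms
   vanish. *)
have := category_ge0 i; rewrite le_eqVlt => /predU1P[p0|pi0].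
  rewrite -p0 mul0e; apply/eqP; rewrite -measure_le0.
  rewrite -[leRHS]/(0%:E) p0 -Pi; apply: le_measure; rewrite ?inE//.
    by apply: measurableI => //; exact: gm_Z_measurable model j i.
  exact: gm_Z_measurable model j i.
rewrite -(gm_X_conditional model (j := j)) ?Pi ?lte_fin// /cond_prob Pi.
by rewrite muleC -muleA mulVe ?mule1// eqe gt_eqF.
Qed.

Lemma model_equivalent (s_gt0 : forall i, 0 < s i) :
  equivalent_measures (distribution P (X j)) (lebesgue_rV R n).
Proof.
split; apply/null_content_dominatesP => A mA.
  move=> A0; rewrite [LHS](model_lawE s_gt0 mA) big1// => i _.
  by rewrite (noisy_segment_eq0 (lt0r_neq0 (s_gt0 i)) _ _ mA).2 ?mule0.
have term_ge0 i : (0 <= (p i)%:E *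
    noisy_segment (stratum_ends G i).1 (stratum_ends G i).2 (s i) A)%E.
  rewrite mule_ge0 ?lee_fin ?category_ge0//.
  by rewrite (noisy_segmentE (lt0r_neq0 (s_gt0 i))).
(* The probabilities sum to 1, so one is positive. A set null for the model is null for the law of
   that stratum, hence for Lebesgue measure. *)
have [i pi0] : exists i, 0 < p i.
  apply: contrapT => /forallNP np; have := category_sum1.
  rewrite big1 => [/eqP|i _]; first by rewrite eq_sym oner_eq0.
  by apply/eqP; rewrite eq_le category_ge0 andbT leNgt; exact/negP.
move=> A0; have := le_sume_nneg i term_ge0.
rewrite -[leRHS](model_lawE s_gt0 mA) [leRHS]A0 le_eqVlt ltNge term_ge0 orbF.
rewrite mule_eq0 eqe gt_eqF//= => /eqP.
exact: (noisy_segment_eq0 (lt0r_neq0 (s_gt0 i)) _ _ mA).1.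
Qed.

End model.

(** * The limit law *)

Section limit.
Context {R : realType} {n N0 N1 : nat} (G : linear_graph R n N0 N1).
Variables (p : 'I_(N0 + N1) -> R) (p_ge0 : forall i, 0 <= p i).
Variable p_sum1 : \sum_(i < N0 + N1) p i = 1.

Definition limit_law : probability 'rV[R]_n R := mixture p_ge0
  (fun i => segment_law (stratum_ends G i).1 (stratum_ends G i).2) p_sum1.

Lemma limit_law_carrier : limit_law (carrier G) = 1%E.
Proof.
rewrite /limit_law/= mixtureE -[RHS]/(1%:E) -p_sum1 -sumEFin.
apply: eq_bigr => i _; rewrite segment_law_full ?mule1//.
  exact: measurable_carrier.
by rewrite carrierE => x ix; exists i.
Qed.

(** The complement of the graph is open and null. Conversely, a point of the graph lies on a top
    stratum, whose law charges all its neighbourhoods with positive weight. *)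
Lemma limit_law_support : (forall i, top_stratum G i -> 0 < p i) ->
  measure_support limit_law = carrier G.
Proof.
move=> p_gt0; apply/seteqP; split => x.
  move=> supp_x; apply: contrapT => Gx.
  have /closed_openC oG := @closed_carrier _ _ _ _ G.
  have := supp_x _ oG Gx.
  rewrite probability_setC; last exact: measurable_carrier.
  by rewrite [X in (1 - X)%E]limit_law_carrier subee// ltxx.
move=> /carrier_top[i ti ix] U oU Ux.
rewrite /limit_law/= mixtureE.
apply: lt_le_trans (le_sume_nneg i _) => [|k]; last first.
  by rewrite mule_ge0// lee_fin.
by rewrite mule_gt0 ?lte_fin ?p_gt0//; exact: segment_law_open_gt0 ix.
Qed.

End limit.

Lemma le_max_noise (R : realType) (N : nat) (s : 'I_N -> R) (i : 'I_N) :
  s i <= max_noise s.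
Proof. exact: le_bigmax. Qed.

(** The integrals against the model and the limit are the same finite combination of integrals over
    strata, so convergence is checked stratum by stratum; the maximal noise bounds the noise of
    each. *)
Lemma model_weak_cvg (R : realType) (n N0 N1 : nat)
  (G : linear_graph R n N0 N1) (p : 'I_(N0 + N1) -> R)
  (p_ge0 : forall i, 0 <= p i) (p_sum1 : \sum_(i < N0 + N1) p i = 1)
  (L : Type) (s : L -> 'I_(N0 + N1) -> R)
  (s_gt0 : forall l i, 0 < s l i)
  (nu : L -> probability 'rV[R]_n R)
  (nuE : forall l A, measurable A -> nu l A =
    (\sum_(i < N0 + N1) (p i)%:E *
      noisy_segment (stratum_ends G i).1 (stratum_ends G i).2 (s l i) A)%E)
  (F : set_system L) {FF : ProperFilter F} :
  max_noise (s l) @[l --> F] --> (0 : R) ->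
  weak_cvg F nu (limit_law G p_ge0 p_sum1).
Proof.
move=> sF f cf [M [_ fM']].
(* [bounded_fun] gives a bound by every number strictly above [M], hence [M + 1]. *)
have {}fM' : forall x, `|f x| <= M + 1.
  by move=> x; apply: fM' => //; rewrite ltrDl.
move: fM'; set M' := M + 1 => fM.
have mf := continuous_measurable_rV_fun cf.
have sn0 l i : s l i != 0 by exact: lt0r_neq0.
pose noisy l i : probability 'rV[R]_n R :=
  distribution (segment_noise (sn0 l i))
    (noisy_point (stratum_ends G i).1 (stratum_ends G i).2).
have nu_mix l :
    \int[nu l]_x f x = \sum_(i < N0 + N1) p i * \int[noisy l i]_x f x.
  rewrite -(Rintegral_mixture p_ge0 p_sum1 _ mf fM).
  congr fine; apply: eq_measure_integral => A mA _.
  exact: etrans (nuE l A mA) (esym (mixtureE p_ge0 p_sum1 (noisy l) A)).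
rewrite (bounded_integralE _ mf fM).
under eq_fun do rewrite (bounded_integralE _ mf fM) nu_mix.
apply: cvg_EFin; first by apply: nearW.
rewrite (Rintegral_mixture p_ge0 p_sum1 _ mf fM).
apply: (cvg_big (op := +%R)) => [|i _]; first exact: add_continuous.
apply: cvgMl_tmp; apply/cvgrPdist_le => e e0.
have [r r0 fr] :=
  noisy_segment_cvg (stratum_ends G i).1 (stratum_ends G i).2 cf fM e0.
have /cvgr_dist_lt /(_ _ r0) := sF; apply: filterS => l.
rewrite sub0r normrN => /(le_lt_trans (ler_norm _)) slr.
by apply: fr => //; exact: le_lt_trans (le_max_noise _ i) slr.
Qed.

(* The models are indexed by a set L of parameters, the model of parameter l
   having the noise vector s l, and sigma -> 0 along any filter F on L for which
   the maximal noise tends to 0 (for instance, L is the set of all positive noise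
   vectors, filtered by their maximum). *)
Theorem corollary3 (R : realType) (n N0 N1 : nat)
  (G : linear_graph R n N0 N1) (p : 'I_(N0 + N1) -> R)
  (L : Type) (s : L -> 'I_(N0 + N1) -> R)
  (s_gt0 : forall (l : L) (i : 'I_(N0 + N1)), 0 < s l i)
  (d : L -> measure_display) (Omega : forall l : L, measurableType (d l))
  (mu : forall l : L, probability (Omega l) R)
  (J : eqType)
  (X : forall l : L, J -> {RV (mu l) >-> 'rV[R]_n})
  (Z : forall l : L, J -> Omega l -> 'I_(N0 + N1))
  (model : forall l : L, graph_mixture G p (s l) (X l) (Z l))
  (j : J) :
  (forall l : L,
     equivalent_measures (distribution (mu l) (X l j)) (lebesgue_rV R n)) /\
  (forall F : set_system L, ProperFilter F ->
     max_noise (s l) @[l --> F] --> (0 : R) ->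
     exists nu0 : probability 'rV[R]_n R,
       [/\ weak_cvg F (fun l => distribution (mu l) (X l j)) nu0,
           (forall i : 'I_(N0 + N1), top_stratum G i -> 0 < p i) ->
             measure_support nu0 = carrier G
         & nu0 (carrier G) = 1%E]).
Proof.
split=> [l|F FF sF]; first exact: (model_equivalent (model l) j (s_gt0 l)).
(* A proper filter provides an index [l]; the model at [l] and [j] shows that [p] is a probability
   vector. *)
have [l _] := filter_ex (filterT : F setT).
have p_ge0 := category_ge0 (model l) j.
have p_sum1 := category_sum1 (model l) j.
exists (limit_law G p_ge0 p_sum1); split.
- pose nu l' : probability 'rV[R]_n R := distribution (mu l') (X l' j).
  have nuE l' A (mA : measurable A) : nu l' A = _ :=
    model_lawE (model l') j (s_gt0 l') mA.
  exact: (model_weak_cvg s_gt0 nuE).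
- exact: limit_law_support.
- exact: limit_law_carrier.
Qed.
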